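(* Let $p\ge 1$ be an integer, let $\xi_{j-1}<\xi_j<\xi_{j+1}$ be real numbers, and let $K_{j-1}=(\xi_{j-1},\xi_j)$ and $K_j=(\xi_j,\xi_{j+1})$ be the two neighboring elements, with lengths $h_{j-1}=\xi_j-\xi_{j-1}$ and $h_j=\xi_{j+1}-\xi_j$. Consider the degree-$p$ B-spline element basis functions $\{B_{K_{j-1},i}\}_{i=p+1}^{2p}$ and $\{B_{K_j,i}\}_{i=1}^{p}$ of these elements (defined in the context, and regarded as functions on $\mathbb{R}$ vanishing outside their support). Set $$B_{m,0,j}(x)=B_{K_{j-1},2p-m}(x),\qquad B_{m,m+1,j}(x)=B_{K_j,m+1}(x)\qquad \forall\, 0\le m\le p-1,$$ and define recursively, for all $1\le m\le p$ and $1\le n\le m$, $$B_{m,n,j}(x)=H_{m,n-1,j}\,B_{m-1,n-1,j}(x)+(1-H_{m,n,j})\,B_{m-1,n,j}(x),\qquad H_{m,n,j}=\frac{(m-n)h_{j-1}}{(m-n)h_{j-1}+n h_j}.$$ Then for all $1\le m\le p$ and $1\le n\le m$, the function $B_{m,n,j}$ is of class $C^{m-1}$ on the union of the two elements including their common endpoint, i.e. on $(\xi_{j-1},\xi_{j+1})$, and $B_{m,n,j}$ is a B-spline of degree $p$.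
   Context: B-splines. Given a nondecreasing sequence of $p+2$ real knots $\tau_1\le\tau_2\le\dots\le\tau_{p+2}$ (not all equal), the B-spline of degree $p$ with these knots is the function $N_{1,p}$ obtained from $$N_{a,0}(x)=\begin{cases}1,&\tau_a\le x<\tau_{a+1},\\0,&\text{otherwise,}\end{cases}\quad 1\le a\le p+1,$$ $$N_{a,q}(x)=\frac{x-\tau_a}{\tau_{a+q}-\tau_a}N_{a,q-1}(x)+\frac{\tau_{a+q+1}-x}{\tau_{a+q+1}-\tau_{a+1}}N_{a+1,q-1}(x),\quad 1\le q\le p,\ 1\le a\le p+1-q,$$ where any fraction with zero denominator is taken to be $0$. ''A B-spline of degree $p$'' means a function obtained this way from some such knot sequence. B-spline element basis functions. For an element $K=(\alpha,\beta)$, $\alpha<\beta$, let $\alpha_s=\alpha+\frac{s}{p}(\beta-\alpha)$, $s=0,1,\dots,p$, be the points dividing $K$ into $p$ equal subintervals. For $1\le i\le 2p$, $B_{K,i}$ is the B-spline of degree $p$ with the following $p+2$ knots: for $1\le i\le p$, the knot $\alpha_0$ repeated $p+2-i$ times followed by $\alpha_1,\dots,\alpha_i$; for $p+1\le i\le 2p$, the knots $\alpha_{i-p-1},\dots,\alpha_{p-1}$ followed by $\alpha_p$ repeated $i-p+1$ times. *)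

(* Defs.v *)
From Stdlib Require Import Reals List Arith.
From Coquelicot Require Import Coquelicot.
Open Scope R_scope.

Definition frac (a b : R) : R := if Req_EM_T b 0 then 0 else a / b.

(** [bspline_rec t q a] is N_{a,q} for the knots t 1 <= t 2 <= ...; it only
    reads t at the indices a, ..., a+q+1.  The half-open convention at degree 0
    makes every B-spline right-continuous. *)
Fixpoint bspline_rec (t : nat -> R) (q a : nat) (x : R) : R :=
  match q with
  | O =>
      if Rle_dec (t a) x then (if Rlt_dec x (t (a + 1)%nat) then 1 else 0) else 0
  | S r =>
      frac (x - t a) (t (a + q)%nat - t a) * bspline_rec t r a x
      + frac (t (a + q + 1)%nat - x) (t (a + q + 1)%nat - t (a + 1)%nat)
        * bspline_rec t r (a + 1)%nat x
  end.

Definition bspline (p : nat) (t : nat -> R) (x : R) : R := bspline_rec t p 1 x.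

(** Only the values t 1, ..., t (p+2) are constrained, and only they matter. *)
Definition knot_sequence (p : nat) (t : nat -> R) : Prop :=
  (forall a : nat, (1 <= a <= p + 1)%nat -> t a <= t (a + 1)%nat) /\
  (exists a b : nat,
      (1 <= a <= p + 2)%nat /\ (1 <= b <= p + 2)%nat /\ t a <> t b).

Definition is_bspline (p : nat) (f : R -> R) : Prop :=
  exists t : nat -> R, knot_sequence p t /\ forall x : R, f x = bspline p t x.

Definition elt_point (p : nat) (alpha beta : R) (s : nat) : R :=
  alpha + INR s / INR p * (beta - alpha).

(** Meaningful for 1 <= i <= 2p, in which case the list has p+2 entries. *)
Definition elt_knots (p : nat) (alpha beta : R) (i : nat) : list R :=
  let pt := elt_point p alpha beta in
  if (i <=? p)%nat
  then repeat (pt 0%nat) (p + 2 - i) ++ map pt (seq 1 i)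
  else map pt (seq (i - p - 1) (2 * p + 1 - i)) ++ repeat (pt p) (i - p + 1).

(** Lists are 0-indexed, knots are 1-indexed. *)
Definition elt_basis (p : nat) (alpha beta : R) (i : nat) : R -> R :=
  bspline p (fun k => nth (k - 1) (elt_knots p alpha beta i) 0).

Definition Hcoef (h0 h1 : R) (m n : nat) : R :=
  (INR m - INR n) * h0 / ((INR m - INR n) * h0 + INR n * h1).

(** The function B_{m,n} at the node [xi1] between the elements (xi0, xi1) and
    (xi1, xi2).  For 1 <= m <= p and 1 <= n <= m only the initial functions
    n = 0 and n = m+1 of levels m <= p-1 are reached; the value 0 for
    m = 0, n > 1 is junk, as are all values with n > m+1. *)
Fixpoint macro_fun (p : nat) (xi0 xi1 xi2 : R) (m n : nat) (x : R) : R :=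
  if (n =? 0)%nat then elt_basis p xi0 xi1 (2 * p - m) x
  else if (n =? m + 1)%nat then elt_basis p xi1 xi2 (m + 1) x
  else match m with
  | O => 0
  | S l =>
      Hcoef (xi1 - xi0) (xi2 - xi1) m (n - 1) * macro_fun p xi0 xi1 xi2 l (n - 1) x
      + (1 - Hcoef (xi1 - xi0) (xi2 - xi1) m n) * macro_fun p xi0 xi1 xi2 l n x
  end.

Definition class_C (k : nat) (f : R -> R) (a b : R) : Prop :=
  forall x : R, a < x < b ->
    (forall i : nat, (i <= k)%nat -> ex_derive_n f i x) /\
    continuous (Derive_n f k) x.

(* Main.v *)
Require Import Defs.
From Stdlib Require Import Reals List Arith.
From Coquelicot Require Import Coquelicot.
From Stdlib Require Import Lra Lia.
Open Scope R_scope.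

(** The function B_{m,n} is the B-spline whose knots are, in order, the point
    [xi1] shifted left by (m+1-n), ..., 1 steps of length h_{j-1}/p, then [xi1]
    repeated p+1-m times, then [xi1] shifted right by 1, ..., n steps of length
    h_j/p.  Both claims follow from this.

    For n = 0 and n = m+1 these are the knots of the element basis functions.
    For the other n, repeating [xi1] once more in the list of B_{m,n} gives a
    list of p+3 knots; without its last entry it is the list of B_{m-1,n-1},
    without its first entry that of B_{m-1,n}.  Inserting a knot writes a
    B-spline as a combination of the two B-splines on the enlarged list
    ([knot_insertion]), and here the coefficients are exactly H_{m,n-1} and
    1 - H_{m,n}; so the recursion is knot insertion read backwards
    ([macro_fun_bspline]).

    As for smoothness, no knot occurs more than p+1-m times, and a B-spline of
    degree p whose knots have multiplicity at most r is of class C^{p-r}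
    ([smooth_bspline_rec]).  On either side of a point x the B-spline is the
    polynomial obtained by running the recursion from frozen degree-zero values,
    the two one-sided limits of the indicator functions.  The two polynomials
    have the same value at x when the degree is at least r
    ([cox_de_boor_jump]); this is continuity.  Their derivatives are
    combinations of the same objects one degree lower
    ([is_derive_cox_de_boor]), so the derivatives agree as well as long as the
    degree permits.

    B-splines divided by the length of their support, called normalized below,
    make all these identities free of case distinctions on repeated knots: the
    Cox-de Boor step becomes (x - t_a) M_a + (t_{a+q+2} - x) M_{a+1}. *)

(** * The recursion started from arbitrary degree-zero data *)

(** The values [e] of the degree-zero functions are kept fixed while [y] varies,
    so this is a polynomial in [y].  With [e] the one-sided limits of the
    indicators at a point, it is the polynomial piece of the B-spline on that
    side of the point. *)
Fixpoint cox_de_boor (t e : nat -> R) (q a : nat) (y : R) : R :=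
  match q with
  | O => e a
  | S r =>
      frac (y - t a) (t (a + q)%nat - t a) * cox_de_boor t e r a y
      + frac (t (a + q + 1)%nat - y) (t (a + q + 1)%nat - t (a + 1)%nat)
        * cox_de_boor t e r (a + 1)%nat y
  end.

(** For a support of length zero, the convention of [frac] makes this 0. *)
Definition normalized (t e : nat -> R) (q a : nat) (y : R) : R :=
  cox_de_boor t e q a y * frac 1 (t (a + q + 1)%nat - t a).

Definition nondecreasing (t : nat -> R) : Prop :=
  forall a b : nat, (a <= b)%nat -> t a <= t b.

Definition admissible (t e : nat -> R) : Prop :=
  forall b : nat, t b = t (b + 1)%nat -> e b = 0.

Lemma frac_mult (a b : R) : frac a b = a * frac 1 b.
Proof. unfold frac; destruct (Req_EM_T b 0); [ring | field; assumption]. Qed.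

Lemma frac_1_cancel (d : R) : d <> 0 -> frac 1 d * d = 1.
Proof. intros H; unfold frac; destruct (Req_EM_T d 0); [easy | field; easy]. Qed.

Lemma frac_1_zero : frac 1 0 = 0.
Proof. unfold frac; destruct (Req_EM_T 0 0); [reflexivity | lra]. Qed.

Lemma cox_de_boor_S (t e : nat -> R) (q a : nat) (y : R) :
  cox_de_boor t e (S q) a y =
  (y - t a) * normalized t e q a y
  + (t (a + q + 2)%nat - y) * normalized t e q (a + 1) y.
Proof.
  unfold normalized; simpl cox_de_boor.
  rewrite (frac_mult (y - t a)), (frac_mult (t _ - y)).
  replace (a + S q)%nat with (a + q + 1)%nat by lia.
  replace (a + 1 + q + 1)%nat with (a + q + 2)%nat by lia.
  replace (a + q + 1 + 1)%nat with (a + q + 2)%nat by lia.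
  ring.
Qed.

(** In the identities below the coefficients c * (t_j - t_i), with c the inverse
    of the same difference, should be 1.  When t_i = t_j they are 0 instead, but
    then they only multiply normalized B-splines supported between these knots,
    which vanish; so cancelling them is always allowed. *)
Lemma normalized_stretch (t e : nat -> R) (q a : nat) (y : R) (i j : nat) :
  nondecreasing t -> (i <= a)%nat -> (a + q + 1 <= j)%nat ->
  normalized t e q a y * (frac 1 (t j - t i) * (t j - t i))
  = normalized t e q a y.
Proof.
  intros ht hi hj.
  destruct (Req_dec (t j - t i) 0) as [h|h].
  - assert (h1 := ht _ _ hi); assert (h2 := ht _ _ hj).
    assert (h3 : t a <= t (a + q + 1)%nat) by (apply ht; lia).
    unfold normalized.
    replace (t (a + q + 1)%nat - t a) with 0 by lra.
    rewrite frac_1_zero; ring.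
  - rewrite frac_1_cancel by assumption; ring.
Qed.

Lemma cox_de_boor_degenerate (t e : nat -> R) (q a : nat) (y : R) :
  nondecreasing t -> admissible t e -> t a = t (a + q + 1)%nat ->
  cox_de_boor t e q a y = 0.
Proof.
  intros ht he; revert a; induction q as [|q IH]; intros a h.
  - apply he. rewrite h; f_equal; lia.
  - rewrite cox_de_boor_S; unfold normalized.
    assert (h1 := ht a (a + 1)%nat ltac:(lia)).
    assert (h2 := ht (a + 1)%nat (a + q + 1)%nat ltac:(lia)).
    assert (h3 := ht (a + q + 1)%nat (a + S q + 1)%nat ltac:(lia)).
    rewrite !IH; [ring | | lra].
    replace (a + 1 + q + 1)%nat with (a + S q + 1)%nat by lia; lra.
Qed.

Lemma cox_de_boor_normalized (t e : nat -> R) (q a : nat) (y : R) :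
  nondecreasing t -> admissible t e ->
  cox_de_boor t e q a y
  = (t (a + q + 1)%nat - t a) * normalized t e q a y.
Proof.
  intros ht he.
  destruct (Req_dec (t (a + q + 1)%nat - t a) 0) as [h|h].
  - rewrite cox_de_boor_degenerate by (auto; lra). rewrite h; ring.
  - assert (hc := frac_1_cancel _ h); unfold normalized.
    transitivity (cox_de_boor t e q a y * 1); [ring | rewrite <- hc at 1; ring].
Qed.

(** * Differentiation *)

Lemma is_derive_blend (f g : R -> R) (a b y f' g' : R) :
  is_derive f y f' -> is_derive g y g' ->
  is_derive (fun z => (z - a) * f z + (b - z) * g z) y
    (f y - g y + (y - a) * f' + (b - y) * g').
Proof.
  intros hf hg; auto_derive.
  - split; [exists f'; exact hf | split; [exists g'; exact hg | easy]].
  - assert (hf' : Derive (fun z => f z) y = f') by exact (is_derive_unique _ _ _ hf).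
    assert (hg' : Derive (fun z => g z) y = g') by exact (is_derive_unique _ _ _ hg).
    rewrite hf', hg'; ring.
Qed.

(** Induction on the degree by the product rule.  In the step, the coefficients
    of the outer normalized B-splines of degree q agree at once; those of the
    middle one differ by c (t_{a+q+2} - t_a) - c' (t_{a+q+3} - t_{a+1}) = 1 - 1,
    where [normalized_stretch] covers the degenerate cases. *)
Lemma is_derive_cox_de_boor (t e : nat -> R) (q a : nat) (y : R) :
  nondecreasing t ->
  is_derive (cox_de_boor t e (S q) a) y
    (INR (S q) * (normalized t e q a y - normalized t e q (a + 1) y)).
Proof.
  intros ht; revert a; induction q as [|q IH]; intros a.
  - apply is_derive_ext with
      (fun y => (y - t a) * normalized t e 0 a 0
                + (t (a + 0 + 2)%nat - y) * normalized t e 0 (a + 1) 0).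
    { intros z; rewrite cox_de_boor_S; reflexivity. }
    unfold normalized; simpl cox_de_boor.
    auto_derive; [easy | simpl; ring].
  - apply is_derive_ext with
      (fun y => (y - t a) * normalized t e (S q) a y
                + (t (a + S q + 2)%nat - y) * normalized t e (S q) (a + 1) y).
    { intros z; rewrite cox_de_boor_S; reflexivity. }
    assert (hm : forall b, is_derive (normalized t e (S q) b) y
       (INR (S q) * (normalized t e q b y - normalized t e q (b + 1) y)
        * frac 1 (t (b + S q + 1)%nat - t b))).
    { intros b; unfold normalized at 1.
      apply (is_derive_ext
        (fun z => scal (frac 1 (t (b + S q + 1)%nat - t b))
                    (cox_de_boor t e (S q) b z))).
      { intros z; unfold scal; simpl; unfold mult; simpl; ring. }
      rewrite Rmult_comm. apply is_derive_scal. apply IH. }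
    evar_last; [apply (is_derive_blend _ _ _ _ _ _ _ (hm a) (hm (a + 1)%nat)) |].
    rewrite (S_INR (S q)).
    assert (hE : forall b, normalized t e (S q) b y =
        ((y - t b) * normalized t e q b y
         + (t (b + q + 2)%nat - y) * normalized t e q (b + 1) y)
        * frac 1 (t (b + S q + 1)%nat - t b))
      by (intros b; rewrite <- cox_de_boor_S; reflexivity).
    rewrite !hE.
    replace (a + 1 + S q + 1)%nat with (a + q + 3)%nat by lia.
    replace (a + S q + 1)%nat with (a + q + 2)%nat by lia.
    replace (a + S q + 2)%nat with (a + q + 3)%nat by lia.
    replace (a + 1 + q + 2)%nat with (a + q + 3)%nat by lia.
    assert (h1 := normalized_stretch t e q (a + 1) y a (a + q + 2) ht
                    ltac:(lia) ltac:(lia)).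
    assert (h2 := normalized_stretch t e q (a + 1) y (a + 1) (a + q + 3) ht
                    ltac:(lia) ltac:(lia)).
    set (A := normalized t e q a y) in *.
    set (B := normalized t e q (a + 1) y) in *.
    set (C := normalized t e q (a + 1 + 1) y) in *.
    set (c := frac 1 (t (a + q + 2)%nat - t a)) in *.
    set (c' := frac 1 (t (a + q + 3)%nat - t (a + 1)%nat)) in *.
    set (N := INR (S q)) in *.
    assert (h3 : N * (B * (c * (t (a + q + 2)%nat - t a)))
               = N * (B * (c' * (t (a + q + 3)%nat - t (a + 1)%nat))))
      by (rewrite h1, h2; reflexivity).
    lra.
Qed.

(** * Jumps at the knots *)

Definition right_data (t : nat -> R) (x : R) (b : nat) : R :=
  bspline_rec t 0 b x.

(** The left limits at [x] of the degree-zero functions, which are themselves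
    right-continuous: this is why the inequalities swap strictness. *)
Definition left_data (t : nat -> R) (x : R) (b : nat) : R :=
  if Rlt_dec (t b) x then (if Rle_dec x (t (b + 1)%nat) then 1 else 0) else 0.

Lemma right_data_admissible (t : nat -> R) (x : R) : admissible t (right_data t x).
Proof.
  intros b h; unfold right_data; simpl.
  destruct (Rle_dec (t b) x); destruct (Rlt_dec x (t (b + 1)%nat)); lra.
Qed.

Lemma bspline_rec_cox_de_boor (t : nat -> R) (q a : nat) (x : R) :
  bspline_rec t q a x = cox_de_boor t (right_data t x) q a x.
Proof.
  revert a; induction q as [|q IH]; intros a; [reflexivity |].
  simpl; rewrite !IH; reflexivity.
Qed.

Lemma right_data_at_right (t : nat -> R) (x : R) (b : nat) :
  locally x (fun y => x < y -> right_data t y b = right_data t x b).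
Proof.
  unfold right_data; simpl.
  destruct (Rlt_dec x (t b)) as [h|h].
  - generalize (open_lt (t b) x h); apply filter_imp; intros y hy hxy.
    destruct (Rle_dec (t b) y), (Rle_dec (t b) x); lra.
  - destruct (Rlt_dec x (t (b + 1)%nat)) as [h'|h'].
    + generalize (open_lt (t (b + 1)%nat) x h'); apply filter_imp; intros y hy hxy.
      destruct (Rle_dec (t b) y), (Rle_dec (t b) x),
        (Rlt_dec y (t (b + 1)%nat)); lra.
    + apply filter_forall; intros y hxy.
      destruct (Rle_dec (t b) y), (Rle_dec (t b) x),
        (Rlt_dec y (t (b + 1)%nat)); lra.
Qed.

Lemma right_data_at_left (t : nat -> R) (x : R) (b : nat) :
  locally x (fun y => y < x -> right_data t y b = left_data t x b).
Proof.
  unfold right_data, left_data; simpl.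
  destruct (Rlt_dec (t b) x) as [h|h].
  - destruct (Rle_dec x (t (b + 1)%nat)) as [h'|h'].
    + generalize (open_gt (t b) x h); apply filter_imp; intros y hy hxy.
      destruct (Rle_dec (t b) y), (Rlt_dec y (t (b + 1)%nat)); lra.
    + generalize (open_gt (t (b + 1)%nat) x ltac:(lra)).
      apply filter_imp; intros y hy hxy.
      destruct (Rle_dec (t b) y), (Rlt_dec y (t (b + 1)%nat)); lra.
  - apply filter_forall; intros y hxy.
    destruct (Rle_dec (t b) y), (Rlt_dec y (t (b + 1)%nat)); lra.
Qed.

(** [P] restricts attention to one side of [x]. *)
Lemma bspline_rec_one_sided (P : R -> Prop) (e : nat -> R) (t : nat -> R) (x : R) :
  (forall b, locally x (fun y => P y -> right_data t y b = e b)) ->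
  forall q a,
    locally x (fun y => P y -> bspline_rec t q a y = cox_de_boor t e q a y).
Proof.
  intros h q; induction q as [|q IH]; intros a; [apply h |].
  generalize (filter_and _ _ (IH a) (IH (a + 1)%nat)).
  apply filter_imp; intros y [h1 h2] hy; simpl.
  rewrite (h1 hy), (h2 hy); reflexivity.
Qed.

(** A B-spline of degree q jumps at [x] only when exactly q+1 of its q+2 knots
    equal [x]: up by 1 if these are the first ones, down by 1 if the last. *)
Definition jump (t : nat -> R) (q b : nat) (x : R) : R :=
  (if Req_EM_T (t b) x then
     if Req_EM_T (t (b + q)%nat) x then
       if Req_EM_T (t (b + q + 1)%nat) x then 0 else 1
     else 0
   else 0)
  - (if Req_EM_T (t b) x then 0 else
       if Req_EM_T (t (b + 1)%nat) x then
         if Req_EM_T (t (b + q + 1)%nat) x then 1 else 0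
       else 0).

(** The difference satisfies the Cox-de Boor recursion itself, so only the closed
    form has to be checked: a jump of the left summand survives, with weight 1,
    only if it is downwards, one of the right summand only if it is upwards, and
    when both survive they cancel. *)
Lemma cox_de_boor_jump (t : nat -> R) (q a : nat) (x : R) :
  nondecreasing t ->
  cox_de_boor t (right_data t x) q a x - cox_de_boor t (left_data t x) q a x
  = jump t q a x.
Proof.
  intros ht; revert a; induction q as [|q IH]; intros a.
  - unfold jump, right_data, left_data; simpl.
    replace (a + 0)%nat with a by lia.
    assert (h := ht a (a + 1)%nat ltac:(lia)).
    destruct (Rle_dec (t a) x), (Rlt_dec x (t (a + 1)%nat)), (Rlt_dec (t a) x),
      (Rle_dec x (t (a + 1)%nat)), (Req_EM_T (t a) x), (Req_EM_T (t (a + 1)%nat) x); lra.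
  - transitivity
      ((x - t a) * frac 1 (t (a + q + 1)%nat - t a) * jump t q a x
       + (t (a + q + 2)%nat - x) * frac 1 (t (a + q + 2)%nat - t (a + 1)%nat)
         * jump t q (a + 1) x).
    { rewrite <- !IH, !cox_de_boor_S; unfold normalized.
      replace (a + 1 + q + 1)%nat with (a + q + 2)%nat by lia; ring. }
    unfold jump.
    replace (a + S q)%nat with (a + q + 1)%nat by lia.
    replace (a + 1 + q + 1)%nat with (a + q + 2)%nat by lia.
    replace (a + q + 1 + 1)%nat with (a + q + 2)%nat by lia.
    replace (a + 1 + q)%nat with (a + q + 1)%nat by lia.
    assert (h1 := ht a (a + 1)%nat ltac:(lia)).
    assert (h2 := ht (a + 1)%nat (a + q + 1)%nat ltac:(lia)).
    assert (h3 := ht (a + q + 1)%nat (a + q + 2)%nat ltac:(lia)).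
    assert (h4 := ht (a + 1)%nat (a + 1 + 1)%nat ltac:(lia)).
    assert (h5 := ht (a + 1 + 1)%nat (a + q + 2)%nat ltac:(lia)).
    assert (h6 := ht a (a + q)%nat ltac:(lia)).
    assert (h7 := ht (a + q)%nat (a + q + 1)%nat ltac:(lia)).
    assert (hc := frac_1_cancel (t (a + q + 1)%nat - t a)).
    assert (hc' := frac_1_cancel (t (a + q + 2)%nat - t (a + 1)%nat)).
    set (c := frac 1 (t (a + q + 1)%nat - t a)) in *.
    set (c' := frac 1 (t (a + q + 2)%nat - t (a + 1)%nat)) in *.
    destruct (Req_EM_T (t a) x) as [e1|e1];
    destruct (Req_EM_T (t (a + 1)%nat) x) as [e2|e2];
    destruct (Req_EM_T (t (a + q + 1)%nat) x) as [e3|e3];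
    destruct (Req_EM_T (t (a + q + 2)%nat) x) as [e4|e4];
    destruct (Req_EM_T (t (a + q)%nat) x) as [e5|e5];
    destruct (Req_EM_T (t (a + 1 + 1)%nat) x) as [e6|e6];
    try (exfalso; lra);
    try rewrite e1 in *; try rewrite e2 in *; try rewrite e3 in *;
    try rewrite e4 in *;
    try (assert (hc1 := hc ltac:(lra))); try (assert (hc1' := hc' ltac:(lra)));
    lra.
Qed.

(** * Smoothness *)

(** Class C^n on the whole line, with explicit derivatives, so that closure
    properties need no differentiability side conditions. *)
Fixpoint smooth (n : nat) (f : R -> R) : Prop :=
  match n with
  | O => forall x : R, continuous f x
  | S k => exists g : R -> R, (forall x : R, is_derive f x (g x)) /\ smooth k g
  end.

Lemma smooth_ext (n : nat) (f g : R -> R) :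
  (forall x, f x = g x) -> smooth n f -> smooth n g.
Proof.
  destruct n as [|n]; intros h; simpl.
  - intros hf x; exact (continuous_ext _ _ _ h (hf x)).
  - intros [f' [hf hs]]; exists f'; split; [| exact hs].
    intros x; exact (is_derive_ext _ _ _ _ h (hf x)).
Qed.

Lemma smooth_linear (n : nat) (f g : R -> R) (c d : R) :
  smooth n f -> smooth n g -> smooth n (fun x => c * f x + d * g x).
Proof.
  revert f g; induction n as [|n IH]; intros f g; simpl.
  - intros hf hg x.
    apply (continuous_plus (fun x => c * f x) (fun x => d * g x)).
    + apply (continuous_scal_r c f), hf.
    + apply (continuous_scal_r d g), hg.
  - intros [f' [hf sf]] [g' [hg sg]].
    exists (fun x => c * f' x + d * g' x); split; [intros x | apply IH; assumption].
    apply (is_derive_plus (fun x => c * f x) (fun x => d * g x)).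
    + apply is_derive_scal, hf.
    + apply is_derive_scal, hg.
Qed.

Lemma smooth_Derive_n (f : R -> R) (i n : nat) :
  smooth (i + n) f -> smooth n (Derive_n f i).
Proof.
  revert n; induction i as [|i IH]; intros n h; [exact h |].
  destruct (IH (S n)) as [g [hg hs]].
  - replace (i + S n)%nat with (S i + n)%nat by lia; exact h.
  - apply smooth_ext with g; [| exact hs].
    intros x; symmetry; apply is_derive_unique, hg.
Qed.

Lemma smooth_class_C (k : nat) (f : R -> R) (a b : R) :
  smooth k f -> class_C k f a b.
Proof.
  intros h x _; split.
  - intros [|i] hi; [exact I |].
    destruct (smooth_Derive_n f i (S (k - S i))) as [g [hg _]].
    + replace (i + S (k - S i))%nat with k by lia; exact h.
    + exists (g x); apply hg.
  - apply (smooth_Derive_n f k 0); rewrite Nat.add_0_r; exact h.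
Qed.

Lemma continuous_glue
    (f g h : R -> R) (x : R) :
  locally x (fun y => y < x -> f y = g y) ->
  locally x (fun y => x < y -> f y = h y) ->
  f x = g x -> f x = h x ->
  continuous g x -> continuous h x -> continuous f x.
Proof.
  intros fg fh fgx fhx cg ch P hP.
  assert (hg := cg P ltac:(rewrite <- fgx; exact hP)).
  assert (hh := ch P ltac:(rewrite <- fhx; exact hP)).
  unfold filtermap in *.
  generalize (filter_and _ _ (filter_and _ _ fg fh) (filter_and _ _ hg hh)).
  apply filter_imp; intros y [[h1 h2] [h3 h4]].
  destruct (Rtotal_order y x) as [l|[l|l]].
  - rewrite h1; assumption.
  - subst y; rewrite fgx; assumption.
  - rewrite h2; assumption.
Qed.

Lemma is_derive_glue
    (f g h : R -> R) (x l : R) :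
  locally x (fun y => y < x -> f y = g y) ->
  locally x (fun y => x < y -> f y = h y) ->
  f x = g x -> f x = h x ->
  is_derive g x l -> is_derive h x l -> is_derive f x l.
Proof.
  intros fg fh fgx fhx [lin dg] [_ dh]; split; [exact lin |].
  intros z hz eps.
  assert (ez : x = z) by (apply (is_filter_lim_locally_unique x z hz)); subst z.
  generalize (filter_and _ _ (filter_and _ _ fg fh)
                (filter_and _ _ (dg x hz eps) (dh x hz eps))).
  apply filter_imp; intros y [[h1 h2] [h3 h4]].
  destruct (Rtotal_order y x) as [l'|[l'|l']].
  - rewrite h1, fgx; assumption.
  - subst y; rewrite fgx; assumption.
  - rewrite h2, fhx; assumption.
Qed.

(** Strict growth over every [r] steps says that no knot occurs more than [r]
    times. *)
Lemma jump_zero (t : nat -> R) (r q a : nat) (x : R) :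
  nondecreasing t -> (forall k, t k < t (k + r)%nat) -> (r <= q)%nat ->
  jump t q a x = 0.
Proof.
  intros ht hr hq.
  assert (h1 := hr a); assert (h2 := ht (a + r)%nat (a + q)%nat ltac:(lia)).
  assert (h3 := hr (a + 1)%nat).
  assert (h4 := ht (a + 1 + r)%nat (a + q + 1)%nat ltac:(lia)).
  unfold jump.
  destruct (Req_EM_T (t a) x), (Req_EM_T (t (a + q)%nat) x),
    (Req_EM_T (t (a + 1)%nat) x), (Req_EM_T (t (a + q + 1)%nat) x); lra.
Qed.

Lemma cox_de_boor_left_right (t : nat -> R) (r q a : nat) (x : R) :
  nondecreasing t -> (forall k, t k < t (k + r)%nat) -> (r <= q)%nat ->
  cox_de_boor t (left_data t x) q a x = bspline_rec t q a x.
Proof.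
  intros ht hr hq; rewrite bspline_rec_cox_de_boor.
  assert (h := cox_de_boor_jump t q a x ht).
  rewrite (jump_zero t r) in h by assumption; lra.
Qed.

Lemma continuous_cox_de_boor (t e : nat -> R) (q a : nat) (x : R) :
  nondecreasing t -> continuous (cox_de_boor t e q a) x.
Proof.
  intros ht; destruct q as [|q]; [apply continuous_const |].
  apply (@ex_derive_continuous R_AbsRing R_NormedModule).
  eexists; apply is_derive_cox_de_boor, ht.
Qed.

(** The right-hand side is made of B-splines of degree [q], for which the left
    and right polynomial pieces still agree at [x]; so the left and right
    derivatives coincide even when [x] is a knot. *)
Lemma is_derive_bspline_rec (t : nat -> R) (r q a : nat) (x : R) :
  nondecreasing t -> (forall k, t k < t (k + r)%nat) -> (r <= q)%nat ->
  is_derive (bspline_rec t (S q) a) x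
    (INR (S q) * frac 1 (t (a + q + 1)%nat - t a) * bspline_rec t q a x
     + - INR (S q) * frac 1 (t (a + q + 2)%nat - t (a + 1)%nat)
       * bspline_rec t q (a + 1) x).
Proof.
  intros ht hr hq.
  apply (is_derive_glue _ (cox_de_boor t (left_data t x) (S q) a)
           (cox_de_boor t (right_data t x) (S q) a)).
  - apply bspline_rec_one_sided; intros b; apply right_data_at_left.
  - apply bspline_rec_one_sided; intros b; apply right_data_at_right.
  - symmetry; apply (cox_de_boor_left_right t r); auto; lia.
  - apply bspline_rec_cox_de_boor.
  - evar_last; [apply is_derive_cox_de_boor, ht |].
    unfold normalized; rewrite !(cox_de_boor_left_right t r) by assumption.
    replace (a + 1 + q + 1)%nat with (a + q + 2)%nat by lia; ring.
  - evar_last; [apply is_derive_cox_de_boor, ht |].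
    unfold normalized; rewrite <- !bspline_rec_cox_de_boor.
    replace (a + 1 + q + 1)%nat with (a + q + 2)%nat by lia; ring.
Qed.

(** At degree [r] nothing jumps; by [is_derive_bspline_rec] each further degree
    gains one derivative. *)
Theorem smooth_bspline_rec (t : nat -> R) (r n a : nat) :
  nondecreasing t -> (forall k, t k < t (k + r)%nat) ->
  smooth n (bspline_rec t (r + n) a).
Proof.
  intros ht hr; revert a; induction n as [|n IH]; intros a.
  - intros x; rewrite Nat.add_0_r.
    apply (continuous_glue _ (cox_de_boor t (left_data t x) r a)
             (cox_de_boor t (right_data t x) r a)).
    + apply bspline_rec_one_sided; intros b; apply right_data_at_left.
    + apply bspline_rec_one_sided; intros b; apply right_data_at_right.
    + symmetry; apply (cox_de_boor_left_right t r); auto.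
    + apply bspline_rec_cox_de_boor.
    + apply continuous_cox_de_boor, ht.
    + apply continuous_cox_de_boor, ht.
  - rewrite Nat.add_succ_r; eexists; split.
    + intros x; apply (is_derive_bspline_rec t r); auto; lia.
    + apply smooth_linear; apply IH.
Qed.

(** * Knot insertion *)

(** The inserted point is the knot [k] itself, which raises its multiplicity. *)
Definition insert_knot (t : nat -> R) (k i : nat) : R :=
  t (if (i <=? k)%nat then i else (i - 1)%nat).

Lemma insert_knot_le (t : nat -> R) (k i : nat) :
  (i <= k)%nat -> insert_knot t k i = t i.
Proof. intros h; unfold insert_knot; destruct (Nat.leb_spec i k); [easy | lia]. Qed.

Lemma insert_knot_gt (t : nat -> R) (k i : nat) :
  (k < i)%nat -> insert_knot t k i = t (i - 1)%nat.
Proof. intros h; unfold insert_knot; destruct (Nat.leb_spec i k); [lia | easy]. Qed.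

Lemma insert_knot_nondecreasing (t : nat -> R) (k : nat) :
  nondecreasing t -> nondecreasing (insert_knot t k).
Proof.
  intros ht a b h; unfold insert_knot.
  destruct (Nat.leb_spec a k), (Nat.leb_spec b k); apply ht; lia.
Qed.

Lemma bspline_rec_shift (t u : nat -> R) (q a b : nat) (x : R) :
  (forall i, (i <= q + 1)%nat -> t (a + i)%nat = u (b + i)%nat) ->
  bspline_rec t q a x = bspline_rec u q b x.
Proof.
  revert a b; induction q as [|q IH]; intros a b h; simpl.
  - assert (h0 := h 0%nat ltac:(lia)); assert (h1 := h 1%nat ltac:(lia)).
    rewrite !Nat.add_0_r in h0; rewrite h0, h1; reflexivity.
  - rewrite (IH a b), (IH (a + 1)%nat (b + 1)%nat).
    + assert (h0 := h 0%nat ltac:(lia)); rewrite !Nat.add_0_r in h0.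
      rewrite <- !Nat.add_assoc, h0, !h by lia; reflexivity.
    + intros i hi; rewrite <- !Nat.add_assoc; apply h; lia.
    + intros i hi; apply h; lia.
Qed.

Definition normalized_bspline (t : nat -> R) (q a : nat) (x : R) : R :=
  bspline_rec t q a x * frac 1 (t (a + q + 1)%nat - t a).

Lemma normalized_bspline_normalized (t : nat -> R) (q a : nat) (x : R) :
  normalized_bspline t q a x = normalized t (right_data t x) q a x.
Proof. unfold normalized_bspline; rewrite bspline_rec_cox_de_boor; reflexivity. Qed.

Lemma bspline_rec_S (t : nat -> R) (q a : nat) (x : R) :
  bspline_rec t (S q) a x =
  (x - t a) * normalized_bspline t q a x
  + (t (a + q + 2)%nat - x) * normalized_bspline t q (a + 1) x.
Proof.
  rewrite bspline_rec_cox_de_boor, !normalized_bspline_normalized.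
  apply cox_de_boor_S.
Qed.

Lemma bspline_rec_normalized (t : nat -> R) (q a : nat) (x : R) :
  nondecreasing t ->
  bspline_rec t q a x
  = (t (a + q + 1)%nat - t a) * normalized_bspline t q a x.
Proof.
  intros ht; rewrite bspline_rec_cox_de_boor, normalized_bspline_normalized.
  apply cox_de_boor_normalized; [exact ht | apply right_data_admissible].
Qed.

(** The Cox-de Boor step has the same shape as this formula, with the variable
    [x] in the place of the inserted knot.  In the induction both sides become
    combinations of three normalized B-splines of lower degree.  The outer
    coefficients agree; the middle ones differ by (x - t_k) times the difference
    of two coefficients that are 1 by [normalized_stretch].  If the repeated knot
    is an end knot, one term vanishes and the other is the original B-spline with
    its indices possibly shifted. *)
Lemma knot_insertion (t : nat -> R) (k q a : nat) (x : R) :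
  nondecreasing t -> (a <= k <= a + q + 1)%nat ->
  bspline_rec t q a x =
  (t k - t a) * normalized_bspline (insert_knot t k) q a x
  + (t (a + q + 1)%nat - t k) * normalized_bspline (insert_knot t k) q (a + 1) x.
Proof.
  intros ht.
  assert (hu := insert_knot_nondecreasing t k ht).
  assert (lo : forall i, (i <= k)%nat -> insert_knot t k i = t i)
    by apply insert_knot_le.
  assert (hi : forall i, (k <= i)%nat -> insert_knot t k (i + 1)%nat = t i).
  { intros i h; rewrite insert_knot_gt by lia; f_equal; lia. }
  set (u := insert_knot t k) in *.
  assert (first : forall q, bspline_rec t q k x =
    (t (k + q + 1)%nat - t k) * normalized_bspline u q (k + 1) x).
  { intros q'.
    rewrite (bspline_rec_shift t u q' k (k + 1)).
    - rewrite bspline_rec_normalized by exact hu.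
      replace (k + 1 + q' + 1)%nat with (k + q' + 1 + 1)%nat by lia.
      rewrite !hi by lia; reflexivity.
    - intros i h; replace (k + 1 + i)%nat with (k + i + 1)%nat by lia.
      rewrite hi by lia; reflexivity. }
  assert (last : forall q a, (k = a + q + 1)%nat -> bspline_rec t q a x =
    (t k - t a) * normalized_bspline u q a x).
  { intros q' a' ->.
    rewrite (bspline_rec_shift t u q' a' a').
    - rewrite bspline_rec_normalized by exact hu.
      rewrite !lo by lia; reflexivity.
    - intros i h; rewrite lo by lia; reflexivity. }
  revert a; induction q as [|q IH]; intros a hk.
  - destruct (Nat.eq_dec k a) as [->|ne]; [rewrite first; ring |].
    rewrite last by lia; replace (a + 0 + 1)%nat with k by lia; ring.
  - destruct (Nat.eq_dec k a) as [->|ne]; [rewrite first; ring |].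
    destruct (Nat.eq_dec k (a + S q + 1)) as [e|ne'].
    { rewrite last by lia; rewrite <- e; ring. }
    assert (h1 := normalized_stretch u (right_data u x) q (a + 1) x a (a + q + 2)
                    hu ltac:(lia) ltac:(lia)).
    assert (h2 := normalized_stretch u (right_data u x) q (a + 1) x (a + 1)
                    (a + q + 3) hu ltac:(lia) ltac:(lia)).
    rewrite <- normalized_bspline_normalized in h1, h2.
    rewrite bspline_rec_S.
    unfold normalized_bspline at 1 2 3 4.
    rewrite (IH a), (IH (a + 1)%nat), !bspline_rec_S by lia.
    replace (a + 1 + q + 1)%nat with (a + q + 2)%nat by lia.
    replace (a + 1 + S q + 1)%nat with (a + q + 3)%nat by lia.
    replace (a + 1 + q + 2)%nat with (a + q + 3)%nat by lia.
    replace (a + S q + 1)%nat with (a + q + 2)%nat by lia.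
    assert (u0 : u a = t a) by (apply lo; lia).
    assert (u1 : u (a + 1)%nat = t (a + 1)%nat) by (apply lo; lia).
    assert (u2 : u (a + q + 2)%nat = t (a + q + 1)%nat).
    { rewrite <- hi by lia; f_equal; lia. }
    assert (u3 : u (a + q + 3)%nat = t (a + q + 2)%nat).
    { rewrite <- hi by lia; f_equal; lia. }
    rewrite u0, u1, u2, u3 in *.
    set (A := normalized_bspline u q a x) in *.
    set (B := normalized_bspline u q (a + 1) x) in *.
    set (C := normalized_bspline u q (a + 1 + 1) x) in *.
    set (c := frac 1 (t (a + q + 1)%nat - t a)) in *.
    set (c' := frac 1 (t (a + q + 2)%nat - t (a + 1)%nat)) in *.
    assert (h3 : (x - t k) * (B * (c * (t (a + q + 1)%nat - t a)))
       = (x - t k) * (B * (c' * (t (a + q + 2)%nat - t (a + 1)%nat))))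
      by (rewrite h1, h2; reflexivity).
    lra.
Qed.

(** * The knots of the macro-element functions *)

(** The knot [z] at the indices [K], ..., [L], continued by steps [d0] to the left
    and [d1] to the right; the truncated differences count the steps.  The
    knots are continued beyond p+2 so that monotonicity and the bound on the
    multiplicities hold at all indices. *)
Definition macro_knots (z d0 d1 : R) (K L k : nat) : R :=
  z - INR (K - k) * d0 + INR (k - L) * d1.

Lemma macro_knots_nondecreasing (z d0 d1 : R) (K L : nat) :
  0 < d0 -> 0 < d1 -> nondecreasing (macro_knots z d0 d1 K L).
Proof.
  intros hd0 hd1 a b h; unfold macro_knots.
  assert (h0 : INR (K - b) <= INR (K - a)) by (apply le_INR; lia).
  assert (h1 : INR (a - L) <= INR (b - L)) by (apply le_INR; lia).
  nra.
Qed.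

Lemma macro_knots_multiplicity (z d0 d1 : R) (K L k : nat) :
  0 < d0 -> 0 < d1 -> (K <= L)%nat ->
  macro_knots z d0 d1 K L k < macro_knots z d0 d1 K L (k + (L + 1 - K))%nat.
Proof.
  intros hd0 hd1 h; unfold macro_knots.
  assert (h0 : INR (K - (k + (L + 1 - K))) <= INR (K - k)) by (apply le_INR; lia).
  assert (h1 : INR (k - L) <= INR (k + (L + 1 - K) - L)) by (apply le_INR; lia).
  destruct (le_lt_dec K k) as [hk|hk].
  - assert (h2 : INR (k - L) < INR (k + (L + 1 - K) - L)) by (apply lt_INR; lia).
    nra.
  - assert (h2 : INR (K - (k + (L + 1 - K))) < INR (K - k)) by (apply lt_INR; lia).
    nra.
Qed.

Lemma macro_knots_insert (z d0 d1 : R) (K L k : nat) :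
  (K <= L)%nat ->
  insert_knot (macro_knots z d0 d1 K L) K k = macro_knots z d0 d1 K (L + 1) k.
Proof.
  intros h; unfold insert_knot, macro_knots.
  destruct (Nat.leb_spec k K).
  - replace (k - L)%nat with (k - (L + 1))%nat by lia; reflexivity.
  - replace (K - (k - 1))%nat with (K - k)%nat by lia.
    replace (k - 1 - L)%nat with (k - (L + 1))%nat by lia; reflexivity.
Qed.

Lemma nth_elt_knots_right (p m k : nat) (alpha beta d : R) :
  (m + 1 <= p)%nat -> (1 <= k <= p + 2)%nat ->
  nth (k - 1) (elt_knots p alpha beta (m + 1)) 0
  = macro_knots alpha d ((beta - alpha) / INR p) 1 (p + 1 - m) k.
Proof.
  intros hm hk; unfold elt_knots, macro_knots.
  destruct (Nat.leb_spec (m + 1) p); [| lia].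
  assert (hp : INR p <> 0) by (apply not_0_INR; lia).
  replace (1 - k)%nat with 0%nat by lia.
  destruct (le_lt_dec k (p + 1 - m)) as [h|h].
  - rewrite app_nth1 by (rewrite repeat_length; lia).
    rewrite nth_repeat_lt by lia.
    replace (k - (p + 1 - m))%nat with 0%nat by lia.
    unfold elt_point; simpl; field; exact hp.
  - rewrite app_nth2; rewrite repeat_length; [| lia].
    rewrite (nth_indep _ _ (elt_point p alpha beta 0))
      by (rewrite length_map, length_seq; lia).
    rewrite map_nth, seq_nth by lia; unfold elt_point.
    replace (1 + (k - 1 - (p + 2 - (m + 1))))%nat with (k - (p + 1 - m))%nat by lia.
    simpl (INR 0); field; exact hp.
Qed.

Lemma nth_elt_knots_left (p m k : nat) (alpha beta d : R) :
  (m + 1 <= p)%nat -> (1 <= k <= p + 2)%nat ->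
  nth (k - 1) (elt_knots p alpha beta (2 * p - m)) 0
  = macro_knots beta ((beta - alpha) / INR p) d (m + 2) (p + 2) k.
Proof.
  intros hm hk; unfold elt_knots, macro_knots.
  destruct (Nat.leb_spec (2 * p - m) p); [lia |].
  assert (hp : INR p <> 0) by (apply not_0_INR; lia).
  replace (k - (p + 2))%nat with 0%nat by lia.
  destruct (le_lt_dec (m + 2) k) as [h|h].
  - rewrite app_nth2; rewrite length_map, length_seq; [| lia].
    rewrite nth_repeat_lt by lia.
    replace (m + 2 - k)%nat with 0%nat by lia.
    unfold elt_point; simpl; field; exact hp.
  - rewrite app_nth1 by (rewrite length_map, length_seq; lia).
    rewrite (nth_indep _ _ (elt_point p alpha beta 0))
      by (rewrite length_map, length_seq; lia).
    rewrite map_nth, seq_nth by lia; unfold elt_point.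
    replace (2 * p - m - p - 1 + (k - 1))%nat with (p - (m + 2 - k))%nat by lia.
    rewrite minus_INR by lia; simpl (INR 0); field; exact hp.
Qed.

Lemma macro_fun_0 (p m : nat) (xi0 xi1 xi2 x : R) :
  macro_fun p xi0 xi1 xi2 m 0 x = elt_basis p xi0 xi1 (2 * p - m) x.
Proof. destruct m; reflexivity. Qed.

Lemma macro_fun_last (p m : nat) (xi0 xi1 xi2 x : R) :
  macro_fun p xi0 xi1 xi2 m (m + 1) x = elt_basis p xi1 xi2 (m + 1) x.
Proof.
  rewrite Nat.add_1_r; destruct m; simpl;
    rewrite ?Nat.add_1_r, ?Nat.eqb_refl; reflexivity.
Qed.

Lemma macro_fun_S (p m n : nat) (xi0 xi1 xi2 x : R) :
  (1 <= n <= S m)%nat ->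
  macro_fun p xi0 xi1 xi2 (S m) n x =
  Hcoef (xi1 - xi0) (xi2 - xi1) (S m) (n - 1) * macro_fun p xi0 xi1 xi2 m (n - 1) x
  + (1 - Hcoef (xi1 - xi0) (xi2 - xi1) (S m) n) * macro_fun p xi0 xi1 xi2 m n x.
Proof.
  intros h; cbn [macro_fun].
  destruct (Nat.eqb_spec n 0); [lia |].
  destruct (Nat.eqb_spec n (S m + 1)); [lia | reflexivity].
Qed.

Lemma knot_ratio (h0 h1 P x y : R) :
  0 < P -> 0 < x * h0 + y * h1 ->
  x * (h0 / P) * frac 1 (x * (h0 / P) + y * (h1 / P)) = x * h0 / (x * h0 + y * h1).
Proof.
  intros hP h.
  replace (x * (h0 / P) + y * (h1 / P)) with ((x * h0 + y * h1) / P) by (field; lra).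
  assert (h' : 0 < (x * h0 + y * h1) / P) by (apply Rdiv_lt_0_compat; assumption).
  unfold frac; destruct (Req_EM_T ((x * h0 + y * h1) / P) 0); [lra | field; lra].
Qed.

(** The functions of index n-1 and n at level m-1 have their
    copies of [xi1] at the indices K, ..., L+1 and K-1, ..., L, where
    K = m+2-n and L = p+2-n are the bounds for B_{m,n}.  These are the enlarged
    knot list starting from its first and from its second entry. *)
Lemma macro_fun_bspline (p : nat) (xi0 xi1 xi2 : R) (m n : nat) (x : R) :
  (1 <= p)%nat -> xi0 < xi1 -> xi1 < xi2 ->
  (n <= m + 1)%nat -> (m + 1 <= p \/ (m <= p /\ 1 <= n <= m))%nat ->
  macro_fun p xi0 xi1 xi2 m n x =
  bspline p (macro_knots xi1 ((xi1 - xi0) / INR p) ((xi2 - xi1) / INR p)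
               (m + 2 - n) (p + 2 - n)) x.
Proof.
  intros hp h01 h12.
  assert (hpp : 0 < INR p) by (apply lt_0_INR; lia).
  set (h0 := xi1 - xi0); set (h1 := xi2 - xi1).
  assert (hh0 : 0 < h0) by (unfold h0; lra).
  assert (hh1 : 0 < h1) by (unfold h1; lra).
  assert (hd0 : 0 < h0 / INR p) by (apply Rdiv_lt_0_compat; lra).
  assert (hd1 : 0 < h1 / INR p) by (apply Rdiv_lt_0_compat; lra).
  revert n; induction m as [|m IH]; intros n hn hm;
    (destruct (Nat.eq_dec n 0) as [->|n0];
     [ rewrite macro_fun_0; unfold elt_basis, bspline; apply bspline_rec_shift;
       intros i hi; rewrite nth_elt_knots_left with (d := h1 / INR p) by lia;
       rewrite !Nat.sub_0_r; reflexivity |]);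
    (match goal with |- context [macro_fun _ _ _ _ ?M] =>
      destruct (Nat.eq_dec n (M + 1)) as [->|n1];
      [ rewrite macro_fun_last; unfold elt_basis, bspline; apply bspline_rec_shift;
        intros i hi; rewrite nth_elt_knots_right with (d := h0 / INR p) by lia;
        f_equal; lia |] end).
  - lia.
  - rewrite macro_fun_S by lia; rewrite !IH by lia.
    fold h0 h1.
    replace (S m + 2 - n)%nat with (m + 3 - n)%nat by lia.
    replace (m + 2 - (n - 1))%nat with (m + 3 - n)%nat by lia.
    replace (p + 2 - (n - 1))%nat with (p + 2 - n + 1)%nat by lia.
    set (K := (m + 3 - n)%nat); set (L := (p + 2 - n)%nat).
    set (t := macro_knots xi1 (h0 / INR p) (h1 / INR p)).
    unfold bspline at 3; rewrite (knot_insertion _ K) by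
      (try apply macro_knots_nondecreasing; unfold K; lra || lia).
    unfold normalized_bspline.
    assert (hu : forall k, insert_knot (t K L) K k = t K (L + 1)%nat k)
      by (intros k; apply macro_knots_insert; unfold K, L; lia).
    rewrite !hu.
    rewrite (bspline_rec_shift (insert_knot _ K) (t K (L + 1)%nat) p 1 1)
      by (intros; apply hu).
    rewrite (bspline_rec_shift (insert_knot _ K) (t (m + 2 - n)%nat L) p 2 1).
    2:{ intros i hi; rewrite hu; unfold t, macro_knots.
        replace (K - (2 + i))%nat with (m + 2 - n - (1 + i))%nat by lia.
        replace (2 + i - (L + 1))%nat with (1 + i - L)%nat by lia.
        reflexivity. }
    assert (val : forall j l k, t j l k
        = xi1 - INR (j - k) * (h0 / INR p) + INR (k - l) * (h1 / INR p))
      by reflexivity.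
    rewrite !val; unfold bspline, Hcoef.
    fold L.
    replace (K - K)%nat with 0%nat by lia.
    replace (K - L)%nat with 0%nat by lia.
    replace (K - 1)%nat with (S m - (n - 1))%nat by lia.
    replace (1 - L)%nat with 0%nat by lia.
    replace (1 - (L + 1))%nat with 0%nat by lia.
    replace (1 + 1 - (L + 1))%nat with 0%nat by lia.
    replace (K - (1 + p + 1))%nat with 0%nat by lia.
    replace (K - (1 + 1 + p + 1))%nat with 0%nat by lia.
    replace (1 + p + 1 - (L + 1))%nat with (n - 1)%nat by lia.
    replace (1 + p + 1 - L)%nat with n by lia.
    replace (1 + 1 + p + 1 - (L + 1))%nat with n by lia.
    replace (K - (1 + 1))%nat with (S m - n)%nat by lia.
    rewrite <- !minus_INR by lia; simpl (INR 0).
    assert (hu0 : 0 < INR (S m - (n - 1))) by (apply lt_0_INR; lia).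
    assert (hu1 := pos_INR (n - 1)).
    assert (hv0 : 0 < INR n) by (apply lt_0_INR; lia).
    assert (hv1 := pos_INR (S m - n)).
    set (u0 := INR (S m - (n - 1))) in *; set (u1 := INR (n - 1)) in *.
    set (v0 := INR n) in *; set (v1 := INR (S m - n)) in *.
    assert (hU : 0 < u0 * h0 + u1 * h1) by nra.
    assert (hV : 0 < v0 * h1 + v1 * h0) by nra.
    match goal with |- _ = _ * (_ * frac 1 ?b) + _ * (_ * frac 1 ?c) =>
      replace b with (u0 * (h0 / INR p) + u1 * (h1 / INR p)) by ring;
      replace c with (v0 * (h1 / INR p) + v1 * (h0 / INR p)) by ring end.
    assert (r0 := knot_ratio h0 h1 (INR p) u0 u1 hpp hU).
    assert (r1 := knot_ratio h1 h0 (INR p) v0 v1 hpp hV).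
    replace (1 - v1 * h0 / (v1 * h0 + v0 * h1))
      with (v0 * h1 / (v0 * h1 + v1 * h0)) by (field; lra).
    rewrite <- r0, <- r1; ring.
Qed.

Theorem theorem1 (p : nat) (xi0 xi1 xi2 : R)
    (hp : (1 <= p)%nat) (h01 : xi0 < xi1) (h12 : xi1 < xi2) :
  forall m n : nat, (1 <= m <= p)%nat -> (1 <= n <= m)%nat ->
    class_C (m - 1) (macro_fun p xi0 xi1 xi2 m n) xi0 xi2 /\
    is_bspline p (macro_fun p xi0 xi1 xi2 m n).
Proof.
  intros m n hm hn.
  assert (hpp : 0 < INR p) by (apply lt_0_INR; lia).
  assert (hd0 : 0 < (xi1 - xi0) / INR p) by (apply Rdiv_lt_0_compat; lra).
  assert (hd1 : 0 < (xi2 - xi1) / INR p) by (apply Rdiv_lt_0_compat; lra).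
  set (t := macro_knots xi1 ((xi1 - xi0) / INR p) ((xi2 - xi1) / INR p)
              (m + 2 - n) (p + 2 - n)).
  assert (hf : forall x, macro_fun p xi0 xi1 xi2 m n x = bspline p t x)
    by (intros x; apply macro_fun_bspline; auto; lia).
  assert (ht : nondecreasing t) by (apply macro_knots_nondecreasing; assumption).
  assert (hr : forall k, t k < t (k + (p + 1 - m))%nat).
  { intros k.
    replace (p + 1 - m)%nat with (p + 2 - n + 1 - (m + 2 - n))%nat by lia.
    apply macro_knots_multiplicity; auto; lia. }
  split.
  - apply smooth_class_C, smooth_ext with (bspline p t); [intros x; symmetry; apply hf |].
    change (smooth (m - 1) (bspline_rec t p 1)).
    (* The largest knot multiplicity is [p + 1 - m]. *)
    replace p with (p + 1 - m + (m - 1))%nat at 1 by lia.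
    apply smooth_bspline_rec; assumption.
  - exists t; split; [split | exact hf].
    + intros a _; apply ht; lia.
    + exists 1%nat, (1 + (p + 1 - m))%nat.
      split; [lia | split; [lia |]].
      apply Rlt_not_eq, hr.
Qed.
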